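(* Let $w$ be a weight on the unit disc $\mathbb{D}$ which is radial and satisfies $0<w(0)<\infty$. Suppose that either $w$ is increasing and satisfies (P7), or $w$ is decreasing and satisfies (P4). Then $w$ is almost constant on top halves.
   Context: $\mathbb{D}=\{z\in\mathbb{C}:|z|<1\}$ carries normalized area measure and $\mathbb{T}=\{|z|=1\}$ carries normalized arc length measure; $|\cdot|$ denotes these measures. $I\subset\mathbb{T}$ always means that $I$ is an interval (arc) of $\mathbb{T}$ of positive length, possibly all of $\mathbb{T}$. The Carleson square of $I$ is $Q_I=\{z\in\mathbb{D}\setminus\{0\}: z/|z|\in I,\ 1-|z|<|I|\}$ and its top half is $T_I=\{z\in\mathbb{D}\setminus\{0\}: z/|z|\in I,\ |I|/2<1-|z|<|I|\}$. For measurable $f$ on $\mathbb{D}$, $Mf(z)=\sup_{I\subset\mathbb{T}:\,z\in Q_I}\frac{1}{|Q_I|}\int_{Q_I}|f|$. A weight on $\mathbb{D}$ is a measurable $w:\mathbb{D}\to[0,\infty]$ with $0<w<\infty$ a.e.; $w(A)=\int_A w$. Properties of an integrable weight $w$ on $\mathbb{D}$ (only integrable weights can have them): (P4) There are $\alpha,\beta\in(0,1)$ such that for every $I\subset\mathbb{T}$ and every measurable $E\subset Q_I$, $|E|<\alpha|Q_I|$ implies $w(E)<\beta w(Q_I)$. (P7) There is $C>0$ such that for every $I\subset\mathbb{T}$, $\int_{Q_I}M(w1_{Q_I})\le C\,w(Q_I)$. A weight $w$ is almost constant on top halves if there is $C\ge1$ with $\operatorname{ess\,sup}_{T_I}w\le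 C\operatorname{ess\,inf}_{T_I}w$ for all $I\subset\mathbb{T}$. A weight $w$ is radial if $w(z)=f(|z|)$ for all $z\in\mathbb{D}$ for some measurable $f:[0,1)\to[0,\infty]$; it is then increasing (resp. decreasing) if $f$ is increasing (resp. decreasing), in the weak (non-strict) sense. *)

(* Defs.v *)
From HB Require Import structures.
From mathcomp Require Import all_boot all_order all_algebra.
From mathcomp Require Import all_classical all_reals all_analysis.
From mathcomp Require Import measurable_realfun ess_sup_inf.

Set Implicit Arguments.
Unset Strict Implicit.
Unset Printing Implicit Defensive.

Import Order.TTheory GRing.Theory Num.Theory.
Import numFieldNormedType.Exports.

Local Open Scope classical_set_scope.
Local Open Scope ring_scope.
Local Open Scope ereal_scope.

(* The complex plane is represented by R * R, with its Borel sigma-algebra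
   (the product of the Borel sigma-algebras of the two factors). *)
Notation plane R := (measurableTypeR R * measurableTypeR R)%type.

(* Complex modulus; the library norm of R * R is the sup norm. *)
Definition cmod {R : realType} (z : plane R) : R :=
  Num.sqrt (z.1 ^+ 2 + z.2 ^+ 2).

Definition expi {R : realType} (t : R) : plane R := (cos t, sin t).

Definition disc {R : realType} : set (plane R) := [set z | (cmod z < 1)%R].

Definition inv_pi_nneg (R : realType) : {nonneg R} :=
  NngNum (eqbRL (invr_ge0 (pi : R)) (pi_ge0 R)).

(* Area measure normalized so that the unit disc has measure 1. *)
Definition area {R : realType} : {measure set (plane R) -> \bar R} :=
  mscale (inv_pi_nneg R) (@lebesgue_measure R \x @lebesgue_measure R).

(* Arc length measure of a subset of the unit circle, normalized so that the
   whole circle has measure 1. *)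
Definition arc_length {R : realType} (I : set (plane R)) : R :=
  (fine (lebesgue_measure
     [set t : R | (0 <= t < 2 * pi)%R /\ I (expi t)]) / (2 * pi))%R.

(* Arcs may be open, closed or half-open, and may be the whole circle. *)
Definition circle_arc {R : realType} (I : set (plane R)) : Prop :=
  (exists2 J : set R, is_interval J & I = expi @` J) /\ (0 < arc_length I)%R.

Definition direction {R : realType} (z : plane R) : plane R :=
  (z.1 / cmod z, z.2 / cmod z)%R.

Definition carleson {R : realType} (I : set (plane R)) : set (plane R) :=
  [set z | [/\ disc z, z != (0%R, 0%R), I (direction z)
             & (1 - cmod z < arc_length I)%R]].

Definition top_half {R : realType} (I : set (plane R)) : set (plane R) :=
  [set z | [/\ disc z, z != (0%R, 0%R), I (direction z)
             & (arc_length I / 2 < 1 - cmod z < arc_length I)%R]].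

(* Only meaningful on the disc minus the origin: no Carleson square contains
   the origin, where the supremum is therefore that of the empty set. *)
Definition maximal {R : realType} (f : plane R -> \bar R) (z : plane R) :
    \bar R :=
  ereal_sup [set ((fine (area (carleson I)))^-1)%:E *
                 \int[area]_(x in carleson I) `|f x|
            | I in [set I | circle_arc I /\ carleson I z]].

(* Functions on the disc are total functions on the plane whose values outside
   the disc are irrelevant. *)
Definition weight {R : realType} (w : plane R -> \bar R) : Prop :=
  [/\ measurable_fun disc w,
      forall z, disc z -> 0 <= w z
    & {ae area, forall z, disc z -> 0 < w z < +oo}].

Definition mass {R : realType} (w : plane R -> \bar R) (A : set (plane R)) :
    \bar R :=
  \int[area]_(z in A) w z.

Definition P4 {R : realType} (w : plane R -> \bar R) : Prop :=
  area.-integrable disc w /\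
  exists alpha beta : R,
    [/\ (0 < alpha < 1)%R, (0 < beta < 1)%R
      & forall I E : set (plane R),
          circle_arc I -> measurable E -> E `<=` carleson I ->
          area E < alpha%:E * area (carleson I) ->
          mass w E < beta%:E * mass w (carleson I)].

(* [w \_ A] is [w] on [A] and 0 elsewhere. *)
Definition P7 {R : realType} (w : plane R -> \bar R) : Prop :=
  area.-integrable disc w /\
  exists2 C : R, (0 < C)%R
    & forall I : set (plane R), circle_arc I ->
        \int[area]_(z in carleson I) maximal (w \_ (carleson I)) z
          <= C%:E * mass w (carleson I).

(* Off [A] the function is replaced by the neutral element of the bound, so
   that only its values on [A] count. *)
Definition ess_sup_on {R : realType} (A : set (plane R))
    (f : plane R -> \bar R) : \bar R :=
  ess_sup area (patch (cst -oo) A f).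

Definition ess_inf_on {R : realType} (A : set (plane R))
    (f : plane R -> \bar R) : \bar R :=
  ess_inf area (patch (cst +oo) A f).

Definition almost_constant_on_top_halves {R : realType}
    (w : plane R -> \bar R) : Prop :=
  exists2 C : R, (1 <= C)%R
    & forall I : set (plane R), circle_arc I ->
        ess_sup_on (top_half I) w <= C%:E * ess_inf_on (top_half I) w.

Definition radial_profile {R : realType} (w : plane R -> \bar R)
    (f : R -> \bar R) : Prop :=
  [/\ measurable_fun [set r : R | (0 <= r < 1)%R] f,
      forall r, (0 <= r < 1)%R -> 0 <= f r
    & forall z, disc z -> w z = f (cmod z)].

Definition radial {R : realType} (w : plane R -> \bar R) : Prop :=
  exists f, radial_profile w f.

Definition radially_increasing {R : realType} (w : plane R -> \bar R) : Prop :=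
  exists2 f, radial_profile w f
    & forall r s : R, (0 <= r)%R -> (r <= s)%R -> (s < 1)%R -> f r <= f s.

Definition radially_decreasing {R : realType} (w : plane R -> \bar R) : Prop :=
  exists2 f, radial_profile w f
    & forall r s : R, (0 <= r)%R -> (r <= s)%R -> (s < 1)%R -> f s <= f r.

(* Main.v *)
From HB Require Import structures.
Require Import Defs.
From mathcomp Require Import all_boot all_order all_algebra.
From mathcomp Require Import all_classical all_reals all_analysis.
From mathcomp Require Import measurable_realfun ess_sup_inf.
From mathcomp Require Import ring lra.

Set Implicit Arguments.
Unset Strict Implicit.
Unset Printing Implicit Defensive.

Import Order.TTheory GRing.Theory Num.Theory.
Import numFieldNormedType.Exports.

Local Open Scope classical_set_scope.
Local Open Scope ring_scope.
Local Open Scope ereal_scope.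

(** A radial weight is determined by its profile [phi], the weight being
[phi |z|] at [z]. The top half of an arc of length [h] consists of points with
[1 - h < |z| < 1 - h / 2], so for a monotone profile the claim is a doubling
property: [phi (1 - h)] and [phi (1 - h / 2)] are comparable, in the direction
that is not granted by monotonicity, uniformly for small [h]
([almost_constant_of_profile]). For large [h] the top half stays in a fixed
smaller disc; there the profile is bounded and bounded below, because it is
finite and positive at [0] and almost everywhere.

Geometry. Call the fan of an arc the set of points of the disc whose direction
lies in the arc. Dilating a fan by [r] multiplies its area by [r ^ 2], hence the
modulus, restricted to any fan, has the same distribution [radial_law] up to the
area of the fan. Consequently the integral of a radial function over a piece of
a fan is the area of the fan times a one-dimensional integral that does not
depend on the arc ([integral_sector], [smass_fan]). This replaces polar
coordinates and rotation invariance. It suffices to test the hypotheses on arcs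
in the upper half circle, where fans are cut out by explicit inequalities.

Decreasing case ([decreasing_doubling]). By (P4), a thin outer shell of the
Carleson square of an arc of length [h], namely the points with
[1 - h < |z| <= 1 - s * h] where [s < 1] is close to [1], carries at most the
proportion [beta] of its mass. So the part [|z| > 1 - s * h] carries at least
the proportion [1 - beta]. The latter mass is at most of order
[h * phi (1 - s * h)] while the whole is at least of order
[h * phi (1 - t * h)] with [s < t < 1]. Thus [phi (1 - t * h)] is at most a
constant times [phi (1 - s * h)], and finitely many iterations replace the ratio
[s / t] by [1 / 2].

Increasing case ([increasing_doubling]). Let [mu s] be the mass of the part
[|z| > 1 - s] of a fan over an arc of length [h]. At a point of the band
[1 - s < |z| <= 1 - s / 2] the maximal function is at least the average over the
Carleson square of a subarc of length [s], hence at least of order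
[mu s / s] ([maximal_ge]). The band has area of order [s], so each of the [n]
dyadic bands [s = h / 2 ^ k], [k < n], contributes at least a constant times
[mu (h / 2 ^ n)] to the integral of the maximal function. By (P7) then
[n * mu (h / 2 ^ n)] is at most a constant times [mu h] ([P7_bands]), and for
large [n] at least half of the mass lies in [|z| <= 1 - h / 2 ^ n]. There the
profile is at most [phi (1 - h / 2 ^ n)], which bounds the whole mass, in
particular the mass near the circle, where the profile is at least
[phi (1 - h / 2 ^ n / 2)]. *)

(** * Image measures and dilations *)

(** The push-forward bundled as a measure, with the measurability of the map as
an explicit argument. *)
Definition image_measure d d' (T1 : measurableType d) (T2 : measurableType d')
    (R : realType) (m : {measure set T1 -> \bar R}) (f : T1 -> T2)
    (mf : measurable_fun setT f) : {measure set T2 -> \bar R}.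
Proof. by refine (pushforward m f : {measure set T2 -> \bar R}). Defined.

Lemma ge0_integral_image d d' (T1 : measurableType d) (T2 : measurableType d')
    (R : realType) (m : {measure set T1 -> \bar R}) (f : T1 -> T2)
    (mf : measurable_fun setT f) (D : set T2) (g : T2 -> \bar R) :
  measurable D -> measurable_fun setT g -> (forall y, 0 <= g y) ->
  \int[image_measure m mf]_(y in D) g y = \int[m]_(x in f @^-1` D) g (f x).
Proof.
move=> mD mg g0.
exact: (ge0_integral_pushforward mf m mD (measurable_funTS mg) (fun y _ => g0 y)).
Qed.

Section dilation.
Context {R : realType}.

Definition dilate (c : R) (z : plane R) : plane R := (c * z.1, c * z.2)%R.

Lemma measurable_mulr (c : R) :
  measurable_fun [set: measurableTypeR R]
    ( *%R c : measurableTypeR R -> measurableTypeR R).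
Proof. exact: measurable_funM. Qed.

Lemma measurable_dilate (c : R) : measurable_fun [set: plane R] (dilate c).
Proof.
by apply: measurable_fun_pair; apply: measurable_funM.
Qed.

(** Both sides are measures in [A], and they agree on half-open intervals. *)
Lemma lebesgue_measure_dilate (c : R) (A : set (measurableTypeR R)) :
  (0 < c)%R -> measurable A ->
  lebesgue_measure A = c%:E * lebesgue_measure ( *%R c @^-1` A).
Proof.
move=> c0 mA.
pose k : {nonneg R} := NngNum (ltW c0).
pose nu : {measure set (measurableTypeR R) -> \bar R} :=
  mscale k (image_measure (@lebesgue_measure R) (measurable_mulr c)).
rewrite -[RHS]/(nu A).
apply: lebesgue_measure_unique => // _ [[a b] _ <-].
rewrite [nu _](_ : _ = c%:E * lebesgue_measure (( *%R c) @^-1` `]a, b])) //.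
have -> : ( *%R c) @^-1` `]a, b] = `](a / c)%R, (b / c)%R]%classic.
  apply/seteqP; split => x /=; rewrite !in_itv/= => /andP[ax xb];
    apply/andP; split.
  - by rewrite ltr_pdivrMr// mulrC.
  - by rewrite ler_pdivlMr// mulrC.
  - by rewrite mulrC -ltr_pdivrMr.
  - by rewrite mulrC -ler_pdivlMr.
rewrite !lebesgue_measure_itv/= !lte_fin ltr_pM2r ?invr_gt0//.
case: ifPn => _; last by rewrite mule0.
by rewrite -!EFinD -EFinM; congr EFin; field; rewrite gt_eqF.
Qed.

(** Both sides are measures in [A], and by [lebesgue_measure_dilate] in each
coordinate they agree on rectangles. *)
Lemma area_dilate (c : R) (A : set (plane R)) :
  (0 < c)%R -> measurable A ->
  area A = (c ^+ 2)%:E * area (dilate c @^-1` A).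
Proof.
move=> c0 mA.
have k0 : (0 <= c ^+ 2)%R by exact: sqr_ge0.
pose k : {nonneg R} := NngNum k0.
pose nu : {measure set (plane R) -> \bar R} :=
  mscale k (image_measure (@lebesgue_measure R \x @lebesgue_measure R)
      (measurable_dilate c)).
have nuE A1 A2 : measurable A1 -> measurable A2 ->
  nu (A1 `*` A2) = lebesgue_measure A1 * lebesgue_measure A2.
  move=> mA1 mA2; rewrite [nu _](_ : _ =
    (c ^+ 2)%:E * (lebesgue_measure \x lebesgue_measure)
    ((( *%R c) @^-1` A1) `*` (( *%R c) @^-1` A2))) //.
  rewrite product_measure1E/=; last 2 first.
  - by rewrite -[X in measurable X]setTI; exact: measurable_mulr.
  - by rewrite -[X in measurable X]setTI; exact: measurable_mulr.
  rewrite (lebesgue_measure_dilate c0 mA1) (lebesgue_measure_dilate c0 mA2).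
  by rewrite expr2 EFinM muleACA.
rewrite /area /= /mscale /=.
rewrite [X in _ * X = _](product_measure_unique nuE mA).
by rewrite /nu /mscale /= muleCA.
Qed.

End dilation.

(** * Fans and sectors *)

Section sectors.
Context {R : realType}.
Implicit Types (I : set (plane R)) (z : plane R).

Definition fan I : set (plane R) :=
  [set z | [/\ disc z, z != (0%R, 0%R) & I (direction z)]].

(** The bound [a < |z| <= b] is half-open so that sectors concatenate, and so
that they match the intervals on which Stieltjes measures are determined. *)
Definition sector I (a b : R) : set (plane R) :=
  fan I `&` cmod @^-1` `]a, b].

Lemma cmod_ge0 z : (0 <= cmod z)%R.
Proof. exact: sqrtr_ge0. Qed.

Lemma cmod_dilate (c : R) z : (0 <= c)%R -> cmod (dilate c z) = (c * cmod z)%R.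
Proof.
move=> c0; rewrite /cmod /= !exprMn -mulrDr sqrtrM ?sqr_ge0//.
by rewrite sqrtr_sqr ger0_norm.
Qed.

Lemma direction_dilate (c : R) z : (0 < c)%R ->
  direction (dilate c z) = direction z.
Proof.
move=> c0; rewrite /direction cmod_dilate ?ltW//=.
by rewrite -!mulf_div divff ?gt_eqF// !mul1r.
Qed.

Lemma dilate_neq0 (c : R) z : (0 < c)%R ->
  (dilate c z != (0, 0)%R) = (z != (0, 0)%R).
Proof.
by move=> c0; case: z => x y; rewrite /dilate !xpair_eqE/= !mulf_eq0 gt_eqF.
Qed.

Lemma carlesonE I : carleson I = sector I (1 - arc_length I) 1.
Proof.
apply/seteqP; split => z /=.
  move=> [dz z0 Iz hz]; split=> //=.
  by rewrite in_itv/= ltrBlDr -ltrBlDl hz ltW.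
by move=> [[dz z0 Iz]] /=; rewrite in_itv/= ltrBlDr -ltrBlDl => /andP[].
Qed.

Lemma measurable_cmod :
  measurable_fun [set: plane R] (cmod : plane R -> measurableTypeR R).
Proof.
have mq : measurable_fun [set: plane R]
    (fun z : plane R => (z.1 ^+ 2 + z.2 ^+ 2)%R : measurableTypeR R).
  by apply: measurable_funD; apply: measurable_funX.
have ms : measurable_fun [set: measurableTypeR R]
    (Num.sqrt : measurableTypeR R -> measurableTypeR R).
  by apply: continuous_measurable_fun; exact: sqrt_continuous.
exact: measurableT_comp ms mq.
Qed.

Lemma measurable_sector I (a b : R) :
  measurable (fan I) -> measurable (sector I a b).
Proof.
move=> mI; apply: measurableI => //.
by rewrite -[X in measurable X]setTI; exact: measurable_cmod.
Qed.

Lemma measurable_disc : measurable (@disc R).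
Proof.
rewrite (_ : disc = cmod @^-1` `]-oo, 1%R[).
  by rewrite -[X in measurable X]setTI; exact: measurable_cmod.
by apply/seteqP; split => z /=; rewrite in_itv.
Qed.

Lemma area_disc_fin : area (@disc R) < +oo.
Proof.
have sub : @disc R `<=` `[(-1)%R, 1%R]%classic `*` `[(-1)%R, 1%R]%classic.
  move=> z; rewrite /disc /cmod /= => h; rewrite !in_itv/= -!ler_norml.
  have h1 : (z.1 ^+ 2 + z.2 ^+ 2 <= 1)%R.
    by move: h; rewrite -[X in (_ < X)%R]sqrtr1 ltr_sqrt ?ltr01// => /ltW.
  by split; rewrite -(@ler_sqr _ _ 1%R) ?nnegrE// expr1n real_normK ?num_real//;
    rewrite (le_trans _ h1)// ?lerDl ?lerDr ?sqr_ge0.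
apply: (@le_lt_trans _ _ (area
    (`[(-1)%R, 1%R]%classic `*` `[(-1)%R, 1%R]%classic : set (plane R)))).
  apply: le_measure; rewrite ?inE //; first exact: measurable_disc.
  exact: measurableX.
rewrite /area /= /mscale /=.
rewrite product_measure1E//= lebesgue_measure_itv/=.
by rewrite lte_fin ifT ?ltry// -!EFinD -!EFinM ltry.
Qed.

Lemma area_fan_fin I : measurable (fan I) -> area (fan I) \is a fin_num.
Proof.
move=> mI; rewrite ge0_fin_numE//; apply: le_lt_trans area_disc_fin.
apply: le_measure; rewrite ?inE//; first exact: measurable_disc.
by move=> z [].
Qed.

(** A fan is a cone intersected with the disc, so its part of modulus less than
[r] is its image under the dilation by [r]. *)
Lemma area_fan_dilate I (r : R) : (0 < r <= 1)%R -> measurable (fan I) ->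
  area (fan I `&` cmod @^-1` `]-oo, r[) = (r ^+ 2)%:E * area (fan I).
Proof.
move=> /andP[r0 r1] mI.
have mS : measurable (fan I `&` (cmod @^-1` `]-oo, r[)).
  apply: measurableI => //.
  by rewrite -[X in measurable X]setTI; exact: measurable_cmod.
rewrite (area_dilate r0 mS); congr (_ * area _).
apply/seteqP; split => z.
  rewrite /fan /disc /preimage /= !in_itv/= cmod_dilate ?ltW//.
  rewrite direction_dilate// dilate_neq0// => -[[_ z0 Iz]].
  by rewrite gtr_pMr.
rewrite /fan /disc /preimage /= !in_itv/= cmod_dilate ?ltW//.
rewrite direction_dilate// dilate_neq0// => -[z1 z0 Iz].
rewrite gtr_pMr//; split=> //; split=> //.
by rewrite (le_lt_trans _ z1)// ler_piMl// cmod_ge0.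
Qed.

End sectors.

(** * The distribution of the modulus on a fan *)

Section radial_law.
Context {R : realType}.
Implicit Types (I : set (plane R)) (z : plane R).

(** The distribution function of the modulus under the uniform law on the unit
disc. *)
Definition radial_cdf (r : R) : R := (Num.min 1 (Num.max 0 r) ^+ 2)%R.

Let clip_ge0 (r : R) : (0 <= Num.min 1 (Num.max 0 r))%R.
Proof. by rewrite le_min ler01 le_max lexx. Qed.

Lemma radial_cdfE (r : R) : (0 <= r <= 1)%R -> radial_cdf r = (r ^+ 2)%R.
Proof. by move=> /andP[r0 r1]; rewrite /radial_cdf max_r// min_r. Qed.

Let radial_cdf_nd : {homo radial_cdf : x y / (x <= y)%R}.
Proof.
move=> x y xy; rewrite /radial_cdf ler_sqr ?nnegrE//.
rewrite le_min ge_min lexx/= ge_min; apply/orP; right.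
by rewrite ge_max !le_max lexx/= xy orbT.
Qed.

Let radial_cdf_rc : right_continuous radial_cdf.
Proof.
apply: right_continuousW => x; rewrite /radial_cdf.
have h : {for x, continuous (fun r : R => (Num.min 1 (Num.max 0 r))%R)}.
  apply: (@continuous_min R R (cst 1%R) (fun r => Num.max 0 r)%R).
    exact: cvg_cst.
  apply: (@continuous_max R R (cst 0%R) id).
    exact: cvg_cst.
  exact: cvg_id.
exact: (cvgM h h).
Qed.

HB.instance Definition _ :=
  isCumulative.Build R _ R radial_cdf radial_cdf_nd radial_cdf_rc.

Definition radial_law : {measure set (measurableTypeR R) -> \bar R} :=
  lebesgue_stieltjes_measure radial_cdf.

(** Passage to the limit [r -> b] from above. *)
Lemma le_of_dilations (n s b : R) : (0 <= s)%R -> (0 <= b < 1)%R ->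
  (forall r, (b < r <= 1)%R -> (n <= r ^+ 2 * s)%R) -> (n <= b ^+ 2 * s)%R.
Proof.
move=> s0 /andP[b0 b1] h; rewrite leNgt; apply/negP => hn.
pose d := (n - b ^+ 2 * s)%R.
have d0 : (0 < d)%R by rewrite subr_gt0.
(* The excess [d] over the claimed bound exceeds the error [2 * e * s]. *)
pose e := Num.min (1 - b)%R (d / (4 * (s + 1)))%R.
have e0 : (0 < e)%R.
  by rewrite lt_min subr_gt0 b1/= divr_gt0// mulr_gt0//; lra.
have e1 : (e <= 1 - b)%R by rewrite ge_min lexx.
have e2 : (e * (4 * (s + 1)) <= d)%R.
  by rewrite -ler_pdivlMr ?ge_min ?lexx ?orbT//; lra.
have hr : (n <= (b + e) ^+ 2 * s)%R by apply: h; lra.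
have h1 : ((b + e) ^+ 2 * s <= b ^+ 2 * s + 2 * e * s)%R.
  have -> : ((b + e) ^+ 2 * s = b ^+ 2 * s + e * s * (2 * b + e))%R by ring.
  rewrite lerD2l [leRHS](_ : _ = (e * s * 2)%R); last by ring.
  by apply: ler_wpM2l; [rewrite mulr_ge0// ltW|lra].
have h2 : (0 <= e * s)%R by rewrite mulr_ge0// ltW.
rewrite /d in d0 e2; nra.
Qed.

(** For closed discs the dilation argument does not apply directly, since the
disc is open; the value is squeezed between those of open discs of radius [b]
and of radii decreasing to [b]. *)
Lemma area_fan_ball I (b : R) : measurable (fan I) ->
  area (fan I `&` cmod @^-1` `]-oo, b]) = (radial_cdf b)%:E * area (fan I).
Proof.
move=> mI.
have mS (i : interval R) : measurable (fan I `&` (cmod @^-1` [set` i])).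
  apply: measurableI => //.
  by rewrite -[X in measurable X]setTI; exact: measurable_cmod.
have [b0|b0] := ltP b 0%R.
  rewrite (_ : _ `&` _ = set0) ?measure0.
    by rewrite /radial_cdf max_l ?ltW// min_r// expr0n mul0e.
  rewrite -subset0 => z [_] /=; rewrite in_itv/= => zb.
  by have := lt_le_trans (le_lt_trans zb b0) (cmod_ge0 z); rewrite ltxx.
have [b1|b1] := leP 1%R b.
  rewrite /radial_cdf max_r// min_l// expr1n mul1e; congr (area _).
  apply/seteqP; split => z; first by case.
  move=> zI; split=> //; case: zI => dz _ _ /=.
  by rewrite in_itv/= (le_trans _ b1)// ltW.
have sfin := area_fan_fin mI.
rewrite radial_cdfE ?b0 ?ltW//.
have nle : area (fan I `&` (cmod @^-1` `]-oo, b])) <= area (fan I).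
  by apply: le_measure; rewrite ?inE//.
have nfin : area (fan I `&` (cmod @^-1` `]-oo, b])) \is a fin_num.
  by rewrite ge0_fin_numE// (le_lt_trans nle)// ltey_eq sfin.
rewrite -(fineK nfin) -(fineK sfin) -EFinM; apply/eqP; rewrite eqe eq_le.
apply/andP; split.
  apply: le_of_dilations; rewrite ?fine_ge0 ?b0//.
  move=> r /andP[br r1]; rewrite -lee_fin EFinM (fineK nfin) (fineK sfin).
  have r01 : (0 < r <= 1)%R by rewrite r1 (le_lt_trans b0 br).
  rewrite -(area_fan_dilate r01 mI).
  apply: le_measure; rewrite ?inE//.
  move=> z [zI] /=; rewrite !in_itv/= => zb; split=> //=.
  by rewrite (le_lt_trans zb).
have [->|bn0] := eqVneq b 0%R.
  by rewrite expr0n mul0r fine_ge0.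
rewrite -lee_fin EFinM (fineK nfin) (fineK sfin).
have b01 : (0 < b <= 1)%R by rewrite lt_neqAle eq_sym bn0 b0 ltW.
rewrite -(area_fan_dilate b01 mI).
apply: le_measure; rewrite ?inE//.
by move=> z [zI] /=; rewrite !in_itv/= => zb; split=> //=; rewrite ltW.
Qed.

Lemma area_sector_cdf I (a b : R) : measurable (fan I) -> (a <= b)%R ->
  area (sector I a b) = (radial_cdf b - radial_cdf a)%:E * area (fan I).
Proof.
move=> mI ab.
have mS (i : interval R) : measurable (fan I `&` (cmod @^-1` [set` i])).
  apply: measurableI => //.
  by rewrite -[X in measurable X]setTI; exact: measurable_cmod.
have -> : sector I a b = (fan I `&` (cmod @^-1` `]-oo, b])) `\`
    (fan I `&` (cmod @^-1` `]-oo, a])).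
  apply/seteqP; split => z /=; rewrite /sector /= !in_itv/=.
    by move=> [zI /andP[az zb]]; split=> // -[_]; rewrite leNgt az.
  move=> [[zI zb] h]; split=> //; rewrite zb andbT ltNge.
  by apply/negP => za; apply: h.
have sfin := area_fan_fin mI.
have bfin : area (fan I `&` cmod @^-1` `]-oo, b]) < +oo.
  by rewrite area_fan_ball// -(fineK sfin) -EFinM; exact: ltry.
rewrite (measureD (mS _) (mS _) bfin).
rewrite [X in _ - area X](_ : _ = fan I `&` (cmod @^-1` `]-oo, a])); last first.
  apply/seteqP; split => z; first by case.
  move=> [zI] /=; rewrite !in_itv/= => za; split=> //.
  by split=> //; rewrite (le_trans za).
rewrite [X in X - _]area_fan_ball// [X in _ - X]area_fan_ball//.
by rewrite -(fineK sfin) -!EFinM -EFinB mulrBl.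
Qed.

Lemma area_sector I (a b : R) : measurable (fan I) ->
  (0 <= a)%R -> (a <= b)%R -> (b <= 1)%R ->
  area (sector I a b) = (b ^+ 2 - a ^+ 2)%:E * area (fan I).
Proof.
move=> mI a0 ab b1; rewrite area_sector_cdf// !radial_cdfE//.
  by rewrite a0 (le_trans ab).
by rewrite b1 (le_trans a0).
Qed.

(** The normalized distribution of the modulus on a fan is a measure on the line
that agrees with [radial_law] on half-open intervals. *)
Lemma radial_lawE I (A : set (measurableTypeR R)) :
  measurable (fan I) -> 0 < area (fan I) -> measurable A ->
  area (fan I `&` cmod @^-1` A) = area (fan I) * radial_law A.
Proof.
move=> mI I0 mA; have sfin := area_fan_fin mI.
have s0 : (0 < fine (area (fan I)))%R.
  by rewrite fine_gt0// I0 ltey_eq sfin.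
have k0 : (0 <= (fine (area (fan I)))^-1)%R by rewrite invr_ge0 ltW.
pose nu : {measure set (measurableTypeR R) -> \bar R} :=
  mscale (NngNum k0) (image_measure (mrestr area mI) measurable_cmod).
have nuE B : nu B =
  (fine (area (fan I)))^-1%:E * area (fan I `&` cmod @^-1` B).
  by rewrite setIC.
have -> : radial_law A = nu A.
  apply: lebesgue_stieltjes_measure_unique => //= _ [[a b] _ <-].
  rewrite nuE /lebesgue_stieltjes_measure /measure_extension/=.
  rewrite measurable_mu_extE/=; last exact: is_ocitv.
  have [ab|ba] := leP a b; last first.
    by rewrite set_itv_ge ?wlength0 ?preimage_set0 ?setI0 ?measure0 ?mule0//
       bnd_simp -leNgt ltW.
  rewrite wlength_itv_bnd// [X in _ * X](area_sector_cdf mI ab).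
  rewrite -(fineK sfin) -!EFinM -?EFinB mulrCA mulVf ?mulr1//.
  by rewrite gt_eqF.
by rewrite nuE -{1}(fineK sfin) muleA -EFinM divff ?gt_eqF// mul1e.
Qed.

(** Integration in polar coordinates of a radial function: the arc enters only
through the area of its fan. *)
Lemma integral_sector I (phi : R -> \bar R) (a b : R) :
  measurable (fan I) -> 0 < area (fan I) ->
  measurable_fun [set: measurableTypeR R] phi -> (forall r, 0 <= phi r) ->
  \int[area]_(z in sector I a b) phi (cmod z) =
  area (fan I) * \int[radial_law]_(r in `]a, b]) phi r.
Proof.
move=> mI I0 mphi phi0; have sfin := area_fan_fin mI.
pose nu : {measure set (measurableTypeR R) -> \bar R} :=
  image_measure (mrestr area mI) measurable_cmod.
pose k : {nonneg R} := NngNum (fine_ge0 (measure_ge0 area (fan I))).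
have mi : measurable (`]a, b] : set (measurableTypeR R)).
  exact: measurable_itv.
have mab : measurable (cmod @^-1` `]a, b] : set (plane R)).
  by rewrite -[X in measurable X]setTI; exact: measurable_cmod.
have mpc : measurable_fun [set: plane R] (fun z => phi (cmod z)).
  exact: measurableT_comp mphi measurable_cmod.
transitivity (\int[mscale k radial_law]_(r in `]a, b]) phi r); last first.
  rewrite ge0_integral_mscale//=; last exact: measurable_funTS.
  by rewrite fineK.
rewrite (eq_measure_integral nu) => [|A mA _]; last first.
  rewrite [RHS](_ : _ = area (fan I `&` cmod @^-1` A)); last by rewrite setIC.
  rewrite (radial_lawE mI I0 mA) [LHS](_ : _ = k%:num%:E * radial_law A)//.
  by rewrite fineK.
rewrite (ge0_integral_image (mrestr area mI) measurable_cmod mi mphi phi0).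
transitivity (\int[mrestr area mI]_(z in sector I a b) phi (cmod z)).
  apply: eq_measure_integral => A mA AS.
  by rewrite [RHS](_ : _ = area (A `&` fan I))// setIidl// => z /AS[].
have -> : sector I a b = cmod @^-1` `]a, b] `\` ~` fan I.
  by rewrite setDE setCK setIC.
rewrite -ge0_negligible_integral//.
- exact: measurableC.
- exact: measurable_funTS.
- by rewrite [LHS](_ : _ = area (~` fan I `&` fan I))// setICl measure0.
Qed.

End radial_law.

(** * Arcs of the upper half circle *)

Section arcs.
Context {R : realType}.
Implicit Types (a b t : R) (z : plane R).

Definition angle_arc a b : set (plane R) := expi @` `[a, b].

Lemma ler_cos t s : (0 <= t <= pi)%R -> (0 <= s <= pi)%R ->
  (cos t <= cos s)%R = (s <= t)%R.
Proof. by move=> ht hs; rewrite leNgt ltr_cos ?in_itv//= -leNgt. Qed.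

Lemma expi_upper_inj t s : (0 <= t < 2 * pi)%R -> (0 <= s <= pi)%R ->
  expi t = expi s -> t = s.
Proof.
move=> /andP[t0 t1] hs [ct st].
have [tpi|tpi] := leP t pi.
  by apply: cos_inj => //; rewrite in_itv/= ?t0.
have : (0 < sin (t - pi))%R.
  by apply: sin_gt0_pi; rewrite subr_gt0 tpi/= ltrBlDr; lra.
rewrite -oppr_lt0 -sinDpi subrK st ltNge.
by rewrite sin_ge0_pi.
Qed.

Lemma arc_length_arc a b : (0 <= a)%R -> (a < b)%R -> (b <= pi)%R ->
  arc_length (angle_arc a b) = ((b - a) / (2 * pi))%R.
Proof.
move=> a0 ab b1; have pi0 := @pi_gt0 R.
rewrite /arc_length; congr (_ / _)%R.
have -> : [set t : R | (0 <= t < 2 * pi)%R /\ angle_arc a b (expi t)] =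
    `[a, b]%classic.
  apply/seteqP; split => t /=; rewrite in_itv/=.
    move=> [ht [s /=]]; rewrite in_itv/= => hs /esym est.
    by rewrite (expi_upper_inj ht _ est)//; lra.
  by move=> tab; split; [lra|exists t => //=; rewrite in_itv].
by rewrite lebesgue_measure_itv/= lte_fin ab -EFinD.
Qed.

Lemma circle_arc_arc a b : (0 <= a)%R -> (a < b)%R -> (b <= pi)%R ->
  circle_arc (angle_arc a b).
Proof.
move=> a0 ab b1; split.
  by exists `[a, b]%classic => //; exact: interval_is_interval.
rewrite arc_length_arc// divr_gt0 ?subr_gt0//.
by rewrite mulr_gt0 ?pi_gt0.
Qed.

Lemma cmod_gt0 z : z != (0, 0)%R -> (0 < cmod z)%R.
Proof.
case: z => x y h; rewrite /cmod/= sqrtr_gt0.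
rewrite lt_neqAle addr_ge0 ?sqr_ge0// andbT eq_sym.
by rewrite paddr_eq0 ?sqr_ge0// !sqrf_eq0 -xpair_eqE.
Qed.

Lemma cmod_sqr z : (cmod z ^+ 2 = z.1 ^+ 2 + z.2 ^+ 2)%R.
Proof. by rewrite sqr_sqrtr// addr_ge0 ?sqr_ge0. Qed.

(** On the upper half circle the cosine decreases, so the angle is controlled by
the first coordinate alone. *)
Lemma fan_arc a b : (0 <= a)%R -> (a < b)%R -> (b <= pi)%R ->
  fan (angle_arc a b) = [set z | [/\ disc z, z != (0, 0)%R, (0 <= z.2)%R &
     (cos b * cmod z <= z.1 <= cos a * cmod z)%R]].
Proof.
move=> a0 ab b1; apply/seteqP; split => z.
  move=> [dz z0 [t /=]]; rewrite in_itv/= => /andP[at_ tb] [ct st].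
  have c0 := cmod_gt0 z0; split=> //.
    rewrite -(pmulr_lge0 _ (_ : (0 < (cmod z)^-1)%R)) ?invr_gt0//.
    by rewrite -st sin_ge0_pi//; lra.
  rewrite -(ler_pdivlMr _ _ c0) -(ler_pdivrMr _ _ c0) -ct !ler_cos ?at_ ?tb//; lra.
move=> [dz z0 y0]; have c0 := cmod_gt0 z0.
rewrite -(ler_pdivlMr _ _ c0) -(ler_pdivrMr _ _ c0) => /andP[h1 h2]; split=> //.
set x := (z.1 / cmod z)%R in h1 h2.
have x1 : (-1 <= x <= 1)%R.
  by rewrite (le_trans (cos_geN1 b) h1) (le_trans h2 (cos_le1 a)).
have acx : cos (acos x) = x by apply: acosK; rewrite in_itv.
have hac : (0 <= acos x <= pi)%R by rewrite acos_ge0// acos_lepi.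
exists (acos x).
  have ha : (0 <= a <= pi)%R by rewrite a0/= ltW// (lt_le_trans ab).
  have hb : (0 <= b <= pi)%R by rewrite b1 andbT ltW// (le_lt_trans a0).
  by rewrite /= in_itv/= -(ler_cos hac ha) -(ler_cos hb hac) acx h1 h2.
rewrite /expi /direction acx; congr (_, _).
rewrite sin_acos//; have c2 := cmod_sqr z.
rewrite (_ : 1 - x ^+ 2 = (z.2 / cmod z) ^+ 2)%R.
  by rewrite sqrtr_sqr ger0_norm// divr_ge0// ltW.
rewrite /x !expr_div_n; apply: (@mulIf _ (cmod z ^+ 2)%R).
  by rewrite expf_neq0// gt_eqF.
rewrite mulrBl !mulfVK ?expf_neq0 ?gt_eqF//.
by rewrite mul1r c2 addrC addKr.
Qed.

Lemma measurable_fan_arc a b : (0 <= a)%R -> (a < b)%R -> (b <= pi)%R ->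
  measurable (fan (angle_arc a b)).
Proof.
move=> a0 ab b1; rewrite fan_arc//.
pose h (c : R) (z : plane R) : measurableTypeR R := (c * cmod z - z.1)%R.
have mh c : measurable_fun [set: plane R] (h c).
  apply: measurable_funB => //; apply: measurable_funM => //.
  exact: measurable_cmod.
have mz : measurable [set z : plane R | z != (0, 0)%R].
  rewrite (_ : mkset _ = cmod @^-1` `]0%R, +oo[).
    by rewrite -[X in measurable X]setTI; exact: measurable_cmod.
  apply/seteqP; split => z /=; rewrite in_itv/= andbT; first exact: cmod_gt0.
  by apply: contraTneq => ->; rewrite /cmod/= expr0n addr0 sqrtr0 ltxx.
rewrite (_ : mkset _ = disc `&` [set z : plane R | z != (0, 0)%R] `&`
   snd @^-1` `[0%R, +oo[ `&` (h (cos b) @^-1` `]-oo, 0%R]) `&`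
   (h (cos a) @^-1` `[0%R, +oo[)).
  repeat apply: measurableI => //; first exact: measurable_disc.
  - by rewrite -[X in measurable X]setTI; exact: measurable_snd.
  - by rewrite -[X in measurable X]setTI; exact: mh.
  - by rewrite -[X in measurable X]setTI; exact: mh.
apply/seteqP; split => z /=; rewrite !in_itv/= !andbT !subr_le0 !subr_ge0.
  by move=> [? ? ? /andP[]].
by move=> [[[[? ?] ?] ->] ->].
Qed.

Lemma continuous_cmod : continuous (fun z : R * R => cmod z).
Proof.
move=> z; apply: (@continuous_comp _ _ _
    (fun z : R * R => z.1 ^+ 2 + z.2 ^+ 2)%R Num.sqrt); last first.
  exact: sqrt_continuous.
by apply: cvgD; apply: cvgM; [exact: cvg_fst..|exact: cvg_snd|exact: cvg_snd].
Qed.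

(** The fan is a neighbourhood of the point of modulus [1 / 2] in the middle
direction, so it contains a square. *)
Lemma area_fan_arc_gt0 a b : (0 <= a)%R -> (a < b)%R -> (b <= pi)%R ->
  0 < area (fan (angle_arc a b)).
Proof.
move=> a0 ab b1; have mf := measurable_fan_arc a0 ab b1.
pose m := ((a + b) / 2)%R.
have hm : (a < m < b)%R by rewrite /m; lra.
pose z0 : R * R := (2^-1 * cos m, 2^-1 * sin m)%R.
have cz0 : cmod z0 = 2^-1%R.
  rewrite /cmod /z0/= !exprMn -mulrDr cos2Dsin2 mulr1 sqrtr_sqr.
  by rewrite ger0_norm.
have sm : (0 < sin m)%R by apply: sin_gt0_pi; lra.
have cmb : (cos b < cos m)%R by rewrite ltr_cos ?in_itv/=; lra.
have cma : (cos m < cos a)%R by rewrite ltr_cos ?in_itv/=; lra.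
have cB (c : R) : {for z0, continuous (fun z : R * R => c * cmod z - z.1)%R}.
  apply: cvgB; last exact: cvg_fst.
  by apply: cvgM; [exact: cvg_cst|exact: continuous_cmod].
have near1 : \forall z \near z0, (0 < z.2)%R.
  have cs : {for z0, continuous (fun z : R * R => z.2)} by exact: cvg_snd.
  have h := cvgr_gt _ cs; apply: h.
  by rewrite /z0/= mulr_gt0.
have near2 : \forall z \near z0, (cos b * cmod z - z.1 < 0)%R.
  have h := cvgr_lt _ (cB (cos b)); apply: h.
  by rewrite cz0/= mulrC -mulrBr pmulr_rlt0// subr_lt0.
have near3 : \forall z \near z0, (0 < cos a * cmod z - z.1)%R.
  have h := cvgr_gt _ (cB (cos a)); apply: h.
  by rewrite cz0/= mulrC -mulrBr pmulr_rgt0// subr_gt0.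
have near4 : \forall z \near z0, (cmod z < 1)%R.
  have cc : {for z0, continuous (fun z : R * R => cmod z)}.
    exact: continuous_cmod.
  have h := cvgr_lt _ cc; apply: h.

  by rewrite cz0; lra.
have : \forall z \near z0, fan (angle_arc a b) z.
  near=> z; rewrite fan_arc//=; split.
  - by near: z; exact: near4.
  - apply/eqP => z00.
    have : (0 < z.2)%R by near: z; exact: near1.
    by rewrite z00 ltxx.
  - by apply: ltW; near: z; exact: near1.
  - apply/andP; split.
      by rewrite -subr_le0 ltW//; near: z; exact: near2.
    by rewrite -subr_ge0 ltW//; near: z; exact: near3.
move=> /nbhs_ballP[e /= e0 he].
pose B : set (plane R) := `](z0.1 - e)%R, (z0.1 + e)%R[%classic `*`
                          `](z0.2 - e)%R, (z0.2 + e)%R[%classic.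
have sub : B `<=` fan (angle_arc a b).
  move=> z [z1 z2]; apply: he; split; rewrite ball_itv/=.
    exact: z1.
  exact: z2.
have mB : measurable B by apply: measurableX; exact: measurable_itv.
apply: (@lt_le_trans _ _ (area B)); last by apply: le_measure; rewrite ?inE.
rewrite /area /= /mscale /= product_measure1E//=.
rewrite !lebesgue_measure_itv/= !lte_fin !ltrD2l.
have -> : (- e < e)%R by rewrite gtrN.
rewrite -!EFinD -!EFinM lte_fin mulr_gt0 ?invr_gt0 ?pi_gt0//.
by rewrite mulr_gt0//; rewrite subr_gt0 ltrD2l gtrN.
Unshelve. all: by end_near. Qed.

End arcs.

(** * Masses of sectors under a radial weight *)

Section integral_bounds.
Context d (T : measurableType d) (R : realType).
Variable mu : {measure set T -> \bar R}.

(** The integral of a nonnegative function is the supremum of the integrals of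
the simple functions below it, so the comparison holds for every upper function
[h], in particular for a supremum over uncountably many arcs. *)
Lemma ge0_le_integralr (D : set T) (g h : T -> \bar R) :
  (forall x, D x -> 0 <= g x) -> (forall x, D x -> g x <= h x) ->
  \int[mu]_(x in D) g x <= \int[mu]_(x in D) h x.
Proof.
move=> g0 gh; have h0 x : D x -> 0 <= h x.
  by move=> Dx; rewrite (le_trans (g0 x Dx))// gh.
rewrite !ge0_integralE//; apply: ereal_sup_le => k /= [s hs <-].
exists s => // x; apply: le_trans (hs x) _; rewrite !patchE.
by case: ifPn => // /set_mem; exact: gh.
Qed.

End integral_bounds.

Section radial_mass.
Context {R : realType}.
Variables (w : plane R -> \bar R) (phi : R -> R).
Hypothesis mphi : measurable_fun [set r : R | (0 <= r < 1)%R] (EFin \o phi).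
Hypothesis phi_ge0 : forall r, (0 <= r < 1)%R -> (0 <= phi r)%R.
Hypothesis wphi : forall z, disc z -> w z = (phi (cmod z))%:E.
Hypothesis iw : area.-integrable disc w.
Implicit Types (I J : set (plane R)) (a b c : R).

Let cmod_disc (z : plane R) : disc z -> (0 <= cmod z < 1)%R.
Proof. by move=> dz; rewrite cmod_ge0. Qed.

Let w_ge0 z : disc z -> 0 <= w z.
Proof. by move=> dz; rewrite wphi// lee_fin phi_ge0// cmod_disc. Qed.

Let mw : measurable_fun disc w.
Proof. exact: measurable_int iw. Qed.

Lemma sector_disc I a b : sector I a b `<=` disc.
Proof. by move=> z [[]]. Qed.

Lemma mass_sector_fin I a b : measurable (fan I) ->
  mass w (sector I a b) \is a fin_num.
Proof.
move=> mI; have mS := measurable_sector a b mI.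
rewrite ge0_fin_numE; last first.
  by apply: integral_ge0 => z /sector_disc; exact: w_ge0.
have /integrableP[_] := iw; apply: le_lt_trans.
apply: (@le_trans _ _ (\int[area]_(z in disc) w z)).
  apply: ge0_subset_integral => //.
  - exact: measurable_disc.
  - exact: sector_disc.
by apply: ge0_le_integralr => // z dz; rewrite gee0_abs// w_ge0.
Qed.

(** The mass as a real number; it is finite since the weight is integrable. *)
Definition smass I a b : R := fine (mass w (sector I a b)).

Lemma smassE I a b : measurable (fan I) ->
  mass w (sector I a b) = (smass I a b)%:E.
Proof. by move=> mI; rewrite fineK// mass_sector_fin. Qed.

Lemma smass_ge0 I a b : (0 <= smass I a b)%R.
Proof.
by apply: fine_ge0; apply: integral_ge0 => z /sector_disc; exact: w_ge0.
Qed.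

Lemma smassD I a c b : measurable (fan I) -> (a <= c)%R -> (c <= b)%R ->
  smass I a b = (smass I a c + smass I c b)%R.
Proof.
move=> mI ac cb; apply/EFin_inj; rewrite EFinD -!smassE// /mass.
have sU : sector I a b = sector I a c `|` sector I c b.
  apply/seteqP; split => z.
    move=> [zI] /=; rewrite in_itv/= => /andP[az zb].
    by have [zc|zc] := leP (cmod z) c; [left|right]; split=> //=;
      rewrite in_itv/= ?az ?zc.
  move=> [] [zI] /=; rewrite in_itv/= => /andP[az zb]; split=> //=.
    by rewrite in_itv/= az (le_trans zb).
  by rewrite in_itv/= zb (le_lt_trans ac).
rewrite sU ge0_integral_setU//.
- exact: measurable_sector.
- exact: measurable_sector.
- rewrite -sU; apply: measurable_funS mw; first exact: measurable_disc.
  exact: sector_disc.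
- by rewrite -sU => z /sector_disc; exact: w_ge0.
- apply/disj_setPLR => z [_] /=; rewrite in_itv/= => /andP[_ zc] [_] /=.
  by rewrite in_itv/= ltNge zc.
Qed.

Lemma smass_mono I a c b : measurable (fan I) -> (a <= c)%R -> (c <= b)%R ->
  (smass I c b <= smass I a b)%R.
Proof. by move=> mI ac cb; rewrite (smassD mI ac cb) lerDr smass_ge0. Qed.

Lemma fine_area_sector I a b : measurable (fan I) ->
  (0 <= a)%R -> (a <= b)%R -> (b <= 1)%R ->
  area (sector I a b) = ((b ^+ 2 - a ^+ 2) * fine (area (fan I)))%:E.
Proof.
by move=> mI a0 ab b1; rewrite area_sector// EFinM fineK// area_fan_fin.
Qed.

Lemma smass_ge I a b (L : R) : measurable (fan I) ->
  (0 <= a)%R -> (a <= b)%R -> (b <= 1)%R -> (0 <= L)%R ->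
  (forall r, (a < r < 1)%R -> (r <= b)%R -> (L <= phi r)%R) ->
  (L * ((b ^+ 2 - a ^+ 2) * fine (area (fan I))) <= smass I a b)%R.
Proof.
move=> mI a0 ab b1 L0 hL; rewrite -lee_fin EFinM -smassE//.
rewrite -fine_area_sector// -integral_cst//; last exact: measurable_sector.
apply: ge0_le_integralr => z; first by rewrite lee_fin.
move=> [[dz _ _]] /=; rewrite in_itv/= => /andP[az zb].
by rewrite wphi// lee_fin hL// az.
Qed.

Lemma smass_le I a b (U : R) : measurable (fan I) ->
  (0 <= a)%R -> (a <= b)%R -> (b <= 1)%R ->
  (forall r, (a < r < 1)%R -> (r <= b)%R -> (phi r <= U)%R) ->
  (smass I a b <= U * ((b ^+ 2 - a ^+ 2) * fine (area (fan I))))%R.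
Proof.
move=> mI a0 ab b1 hU; rewrite -lee_fin EFinM -smassE//.
rewrite -fine_area_sector// -integral_cst//; last exact: measurable_sector.
apply: ge0_le_integralr => z; first by move/sector_disc; exact: w_ge0.
move=> [[dz _ _]] /=; rewrite in_itv/= => /andP[az zb].
by rewrite wphi// lee_fin hU// az.
Qed.

(** The average of a radial weight over the part of a fan between two given radii
is the same for all arcs. *)
Lemma smass_fan I J a b : measurable (fan I) -> measurable (fan J) ->
  0 < area (fan I) -> 0 < area (fan J) ->
  (fine (area (fan J)) * smass I a b = fine (area (fan I)) * smass J a b)%R.
Proof.
move=> mI mJ I0 J0.
pose psi : R -> \bar R := (EFin \o phi) \_ [set r : R | (0 <= r < 1)%R].
have m01 : measurable ([set r : R | (0 <= r < 1)%R] : set (measurableTypeR R)).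
  rewrite (_ : mkset _ = `[0%R, 1%R[%classic); first exact: measurable_itv.
  by apply/seteqP; split => r /=; rewrite in_itv.
have mpsi : measurable_fun [set: measurableTypeR R] psi.
  exact/(measurable_restrictT _ m01).
have psi0 r : 0 <= psi r.
  by apply: erestrict_ge0 => x hx; rewrite lee_fin phi_ge0.
have E K : measurable (fan K) -> 0 < area (fan K) ->
    (smass K a b)%:E =
    (fine (area (fan K)))%:E * \int[radial_law]_(r in `]a, b]) psi r.
  move=> mK K0; rewrite -smassE// fineK ?area_fan_fin// /mass.
  rewrite -integral_sector//; apply: eq_integral => z /set_mem /sector_disc dz.
  by rewrite wphi// /psi patchE mem_set//= cmod_ge0.
by apply/EFin_inj; rewrite EFinM (E I mI I0) [RHS]EFinM (E J mJ J0) muleCA.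
Qed.

End radial_mass.

(** * Decreasing profiles *)

Section small_arcs.
Context {R : realType}.

Lemma small_arc (a h : R) :
  (0 <= a)%R -> (0 < h)%R -> (a + 2 * pi * h <= pi)%R ->
  [/\ circle_arc (angle_arc a (a + 2 * pi * h)),
      arc_length (angle_arc a (a + 2 * pi * h)) = h,
      measurable (fan (angle_arc a (a + 2 * pi * h)))
    & 0 < area (fan (angle_arc a (a + 2 * pi * h)))].
Proof.
move=> a0 h0 ah; have pi0 := @pi_gt0 R.
have ab : (a < a + 2 * pi * h)%R by rewrite ltrDl !mulr_gt0.
split; [exact: circle_arc_arc| |exact: measurable_fan_arc|
  exact: area_fan_arc_gt0].
rewrite arc_length_arc// addrC addKr mulrC mulKf//.
by rewrite mulf_neq0 ?pnatr_eq0// gt_eqF.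
Qed.

Definition initial_arc (h : R) : set (plane R) := angle_arc 0 (2 * pi * h).

Lemma initial_arcP (h : R) : (0 < h <= 2^-1)%R ->
  [/\ circle_arc (initial_arc h),
      arc_length (initial_arc h) = h,
      measurable (fan (initial_arc h))
    & 0 < area (fan (initial_arc h))].
Proof.
move=> /andP[h0 h1]; have pi0 := @pi_gt0 R.
have := @small_arc 0 h (lexx _) h0; rewrite add0r /initial_arc; apply.
by rewrite -mulrA mulrCA -[leRHS]mulr1; apply: (ler_wpM2l (ltW pi0)); lra.
Qed.

End small_arcs.

Lemma exprn_small (R : realType) (kappa e : R) : (0 < kappa < 1)%R -> (0 < e)%R ->
  exists n : nat, (kappa ^+ n <= e)%R.
Proof.
move=> /andP[k0 k1] e0.
have k1' : (`|kappa| < 1)%R by rewrite gtr0_norm.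
have h := cvgr_lt _ (cvg_expr k1') _ e0.
by case: h => n _ hn; exists n; apply: ltW; apply: hn => /=.
Qed.

Section decreasing_profile.
Context {R : realType}.
Variables (w : plane R -> \bar R) (phi : R -> R).
Hypothesis phi_ge0 : forall r, (0 <= r < 1)%R -> (0 <= phi r)%R.
Hypothesis wphi : forall z, disc z -> w z = (phi (cmod z))%:E.
Hypothesis phi_dec : forall r s, (0 <= r)%R -> (r <= s)%R -> (s < 1)%R ->
  (phi s <= phi r)%R.
Hypothesis w_P4 : P4 w.

Let iw : area.-integrable disc w.
Proof. by case: w_P4. Qed.

(** (P4) applied to a shell [1 - h < |z| <= c] of the Carleson square; the area
proportion of a shell depends on the radii alone. *)
Lemma P4_radial : exists alpha beta : R,
  [/\ (0 < alpha < 1)%R, (0 < beta < 1)%R &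
    forall h c : R, (0 < h <= 2^-1)%R -> (1 - h <= c <= 1)%R ->
      (c ^+ 2 - (1 - h) ^+ 2 < alpha * (1 - (1 - h) ^+ 2))%R ->
      ((1 - beta) * smass w (initial_arc h) (1 - h) 1 <=
       smass w (initial_arc h) c 1)%R].
Proof.
have [_ [alpha [beta [hal hbe hP4]]]] := w_P4.
exists alpha, beta; split=> // h c hh /andP[hc c1] hlt.
have [cI lI mI I0] := initial_arcP hh.
have fin := area_fan_fin mI.
have sg0 : (0 < fine (area (fan (initial_arc h))))%R.
  by rewrite fine_gt0// I0 ltey_eq fin.
have h1 : (0 <= 1 - h)%R.
  by case/andP: hh => _ h2; rewrite subr_ge0 (le_trans h2)// invf_le1// ler1n.
have cE : carleson (initial_arc h) = sector (initial_arc h) (1 - h) 1.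
  by rewrite carlesonE lI.
have := hP4 (initial_arc h) (sector (initial_arc h) (1 - h) c) cI.
rewrite cE => /(_ (measurable_sector _ _ mI)) {}hP4.
have small : (smass w (initial_arc h) (1 - h) c <
    beta * smass w (initial_arc h) (1 - h) 1)%R.
  rewrite -lte_fin EFinM -!(smassE phi_ge0 wphi iw _ _ mI); apply: hP4.
    move=> z [zI] /=; rewrite in_itv/= => /andP[za _]; split=> //=.
    by rewrite in_itv/= za; case: zI => /ltW.
  rewrite (fine_area_sector mI h1 hc c1).
  rewrite (fine_area_sector mI h1 (le_trans hc c1) (lexx _)).
  by rewrite -EFinM lte_fin (mulrA alpha) ltr_pM2r// expr1n.
have sum := smassD phi_ge0 wphi iw mI hc c1.
by rewrite mulrBl mul1r lerBlDr [leLHS]sum addrC lerD2l ltW.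
Qed.

(** For a decreasing profile, [phi b] bounds the mass of [1 - h < |z| <= b] from
below and [phi c] bounds that of [|z| > c] from above; the area of the fan
cancels. *)
Lemma decreasing_step (h b c k : R) : (0 < h <= 2^-1)%R -> (0 <= k)%R ->
  (1 - h <= b)%R -> (b <= c)%R -> (c < 1)%R ->
  (k * smass w (initial_arc h) (1 - h) 1 <= smass w (initial_arc h) c 1)%R ->
  (k * ((b ^+ 2 - (1 - h) ^+ 2) * phi b) <= (1 - c ^+ 2) * phi c)%R.
Proof.
move=> hh k0 hb bc c1 hk.
have [cI lI mI I0] := initial_arcP hh.
have fin := area_fan_fin mI.
have sg0 : (0 < fine (area (fan (initial_arc h))))%R.
  by rewrite fine_gt0// I0 ltey_eq fin.
have h1 : (0 <= 1 - h)%R.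
  by case/andP: hh => _ h2; rewrite subr_ge0 (le_trans h2)// invf_le1// ler1n.
have b0 := le_trans h1 hb; have c0 := le_trans b0 bc.
have b1 := ltW (le_lt_trans bc c1).
have upper := smass_le phi_ge0 wphi iw (U := phi c) mI c0 (ltW c1) (lexx _).
have {}upper := upper (fun r hr _ =>
  phi_dec c0 (ltW (proj1 (andP hr))) (proj2 (andP hr))).
have lower := smass_ge phi_ge0 wphi iw (L := phi b) mI h1 hb b1.
have {}lower := lower (phi_ge0 (introT andP (conj b0 (le_lt_trans bc c1)))).
have {}lower := lower (fun r hr hrb =>
  phi_dec (le_trans h1 (ltW (proj1 (andP hr)))) hrb (le_lt_trans bc c1)).
have part : (smass w (initial_arc h) (1 - h) b <=
    smass w (initial_arc h) (1 - h) 1)%R.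
  by rewrite (smassD phi_ge0 wphi iw mI hb b1) lerDl (smass_ge0 phi_ge0 wphi).
rewrite -(ler_pM2r sg0).
apply: le_trans (_ : _ <= k * smass w (initial_arc h) (1 - h) 1)%R _.
  rewrite -mulrA; apply: ler_wpM2l => //.
  by apply: le_trans part; rewrite mulrAC mulrC.
apply: le_trans hk (le_trans upper _).
by rewrite expr1n mulrA (mulrC (phi c)).
Qed.

Lemma decreasing_comparison : exists C kappa : R,
  [/\ (0 <= C)%R, (0 < kappa < 1)%R &
    forall h, (0 < h <= 4^-1)%R -> (phi (1 - h) <= C * phi (1 - kappa * h))%R].
Proof.
have [alpha [beta [/andP[al0 al1] /andP[be0 be1] hP4]]] := P4_radial.
(* The shell [1 - H < |z| <= 1 - s * H] has area proportion at most
   [2 * (1 - s)]; any [t] strictly between [s] and [1] would do. *)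
have [s [t [sE hs ht st]]] : exists s t : R, [/\ (s = 1 - alpha / 4)%R,
    (3 / 4 <= s)%R, (7 / 8 <= t < 1)%R & (s < t)%R].
  exists (1 - alpha / 4)%R, (1 - alpha / 8)%R; split=> //; lra.
have t0 : (0 < t)%R by lra.
exists (2 / ((1 - beta) * (1 - t)))%R, (s / t)%R; split.
- by rewrite divr_ge0// mulr_ge0//; lra.
- by rewrite divr_gt0//= ?ltr_pdivrMr//; lra.
move=> h /andP[h0 h4].
have [H hH] : exists H : R, h = (t * H)%R.
  by exists (h / t)%R; rewrite mulrC divfK// gt_eqF.
have H0 : (0 < H)%R by move: h0; rewrite hH pmulr_rgt0.
have H2 : (H <= 2^-1)%R by nra.
have -> : (s / t * h = s * H)%R by rewrite hH mulrA divfK// gt_eqF.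
rewrite {}hH in h0 h4 *.
have hh : (0 < H <= 2^-1)%R by rewrite H0.
have sH : (0 < s * H)%R by rewrite mulr_gt0//; lra.
have tH : (s * H < t * H)%R by rewrite ltr_pM2r.
have tH1 : (t * H < H)%R by rewrite gtr_pMl//; lra.
have mass_le : ((1 - beta) * smass w (initial_arc H) (1 - H) 1 <=
    smass w (initial_arc H) (1 - s * H) 1)%R.
  apply: hP4 => //; first by lra.
  have -> : ((1 - s * H) ^+ 2 - (1 - H) ^+ 2 =
      alpha * (H * ((2 - H - s * H) / 4)))%R by rewrite sE; field.
  have -> : (1 - (1 - H) ^+ 2 = H * (2 - H))%R by ring.
  by rewrite !ltr_pM2l//; lra.
have step : ((1 - beta) * (((1 - t * H) ^+ 2 - (1 - H) ^+ 2) * phi (1 - t * H))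
    <= (1 - (1 - s * H) ^+ 2) * phi (1 - s * H))%R.
  by apply: (decreasing_step hh) mass_le; lra.
have ps : (0 <= phi (1 - s * H))%R by apply: phi_ge0; lra.
have pt : (0 <= phi (1 - t * H))%R by apply: phi_ge0; lra.
move: (phi (1 - s * H))%R (phi (1 - t * H))%R step ps pt => p q step p0 q0.
clear hP4 mass_le sE.
rewrite mulrAC ler_pdivlMr; last by rewrite mulr_gt0; lra.
rewrite -(ler_pM2l H0).
have e1 : ((1 - t) * H <= (1 - t * H) ^+ 2 - (1 - H) ^+ 2)%R.
  have -> : ((1 - t * H) ^+ 2 - (1 - H) ^+ 2 =
    ((1 - t) * H) * (2 - H - t * H))%R by ring.
  by rewrite ler_peMr; [| rewrite mulr_ge0; lra | lra].
have e2 : (1 - (1 - s * H) ^+ 2 <= 2 * H)%R.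
  have -> : (1 - (1 - s * H) ^+ 2 = 2 * (s * H) - (s * H) ^+ 2)%R by ring.
  by have := sqr_ge0 (s * H)%R; lra.
apply: le_trans (_ : _ <= (1 - beta) *
  (((1 - t * H) ^+ 2 - (1 - H) ^+ 2) * q))%R _.
  rewrite [leLHS](_ : _ = (1 - beta) * ((1 - t) * H * q))%R; last by ring.
  by apply: ler_wpM2l; [lra|exact: ler_wpM2r].
apply: le_trans step _.
by rewrite mulrA (mulrC H); exact: ler_wpM2r.
Qed.

Lemma decreasing_doubling : exists2 C : R, (0 <= C)%R &
  forall h, (0 < h <= 4^-1)%R -> (phi (1 - h) <= C * phi (1 - h / 2))%R.
Proof.
have [C [kappa [C0 /andP[k0 k1] hC]]] := decreasing_comparison.
have [n hn] : exists n : nat, (kappa ^+ n <= 2^-1)%R.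
  by apply: exprn_small; rewrite ?k0.
exists (C ^+ n)%R; first exact: exprn_ge0.
move=> h /andP[h0 h4].
have iter m : (phi (1 - h) <= C ^+ m * phi (1 - kappa ^+ m * h))%R.
  elim: m => [|m IH]; first by rewrite !expr0 !mul1r.
  apply: le_trans IH _; rewrite exprSr -mulrA; apply: ler_wpM2l.
    exact: exprn_ge0.
  rewrite exprS -mulrA; apply: hC.
  have km : (kappa ^+ m <= 1)%R by rewrite exprn_ile1// ltW.
  by rewrite mulr_gt0 ?exprn_gt0//= (le_trans (ler_piMl (ltW h0) km)).
apply: le_trans (iter n) _; apply: ler_wpM2l; first exact: exprn_ge0.
have kn : (kappa ^+ n * h <= h / 2)%R by rewrite (mulrC h) ler_wpM2r// ltW.
have kn0 : (0 < kappa ^+ n * h)%R by rewrite mulr_gt0// exprn_gt0.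
by apply: phi_dec; lra.
Qed.

End decreasing_profile.

(** * Increasing profiles *)

(** With [m], [n] the masses and [x], [y] the areas of two fans of equal average,
the mean of the second over [|z| > 1 - s] is at least of order [m / (s * x)]. *)
Lemma average_transfer (R : realType) (m n x y s : R) :
  (0 <= n)%R -> (0 < x)%R -> (0 < y)%R -> (0 < s <= 1)%R ->
  (y * m = x * n)%R ->
  (m / (2 * s * x) <= ((1 ^+ 2 - (1 - s) ^+ 2) * y)^-1 * n)%R.
Proof.
move=> n0 x0 y0 /andP[s0 s1] E.
have q0 : (0 < 1 ^+ 2 - (1 - s) ^+ 2)%R by nra.
have q2 : (1 ^+ 2 - (1 - s) ^+ 2 <= 2 * s)%R by nra.
move: (1 ^+ 2 - _)%R q0 q2 => q q0 q2.
have -> : m = (n / y * x)%R.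
  by rewrite mulrAC (mulrC n) -E mulrAC mulfV ?mul1r// gt_eqF.
have -> : (n / y * x / (2 * s * x) = n / y * (2 * s)^-1)%R.
  by field; rewrite !gt_eqF.
have -> : ((q * y)^-1 * n = n / y * q^-1)%R by field; rewrite !gt_eqF.
apply: ler_wpM2l; first by rewrite divr_ge0// ltW.
by rewrite lef_pV2// posrE mulr_gt0.
Qed.

(** The band [1 - s < |z| <= 1 - s / 2] has area at least [s / 2] times that of
its fan, so a lower bound of order [m / s] on it integrates to order [m],
whatever [s]. *)
Lemma band_area_ge (R : realType) (m s x : R) :
  (0 <= m)%R -> (0 < s <= 2^-1)%R -> (0 < x)%R ->
  (m / 4 <= m / (2 * s * x) * (((1 - s / 2) ^+ 2 - (1 - s) ^+ 2) * x))%R.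
Proof.
move=> m0 /andP[s0 s1] x0.
have -> : (m / (2 * s * x) * (((1 - s / 2) ^+ 2 - (1 - s) ^+ 2) * x) =
    m * ((1 - 3 / 4 * s) / 2))%R by field; rewrite !gt_eqF.
by apply: ler_wpM2l => //; lra.
Qed.

Section increasing_profile.
Context {R : realType}.
Variables (w : plane R -> \bar R) (phi : R -> R).
Hypothesis mphi : measurable_fun [set r : R | (0 <= r < 1)%R] (EFin \o phi).
Hypothesis phi_ge0 : forall r, (0 <= r < 1)%R -> (0 <= phi r)%R.
Hypothesis wphi : forall z, disc z -> w z = (phi (cmod z))%:E.
Hypothesis phi_inc : forall r s, (0 <= r)%R -> (r <= s)%R -> (s < 1)%R ->
  (phi r <= phi s)%R.
Hypothesis w_P7 : P7 w.

Let iw : area.-integrable disc w.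
Proof. by case: w_P7. Qed.

Lemma subarc_containing (h s : R) (d : plane R) : (0 < s)%R -> (s <= h)%R ->
  initial_arc h d -> exists2 a : R, (0 <= a <= 2 * pi * (h - s))%R &
    angle_arc a (a + 2 * pi * s) d.
Proof.
move=> s0 sh [t /=]; rewrite in_itv/= => /andP[t0 th] <-.
have pi0 := @pi_gt0 R.
have u0 : (0 <= 2 * pi * (h - s))%R by rewrite !mulr_ge0 ?subr_ge0// ltW.
have s0' : (0 <= 2 * pi * s)%R by rewrite !mulr_ge0 ?subr_ge0// ltW.
have [tu|tu] := leP t (2 * pi * (h - s))%R.
  exists t; first by rewrite t0.
  by exists t => //=; rewrite in_itv/= lexx lerDl.
exists (2 * pi * (h - s))%R; first by rewrite u0 lexx.
by exists t => //=; rewrite in_itv/= ltW// -mulrDr subrK.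
Qed.

(** The competitor is the Carleson square of a subarc of length [s] containing
the direction of [z]; its average is transferred back to the large arc. *)
Lemma maximal_ge (h s : R) (z : plane R) : (0 < h <= 2^-1)%R ->
  (0 < s <= h)%R -> sector (initial_arc h) (1 - s) 1 z ->
  (smass w (initial_arc h) (1 - s) 1 /
    (2 * s * fine (area (fan (initial_arc h)))))%:E
  <= maximal (w \_ (carleson (initial_arc h))) z.
Proof.
move=> hh /andP[s0 sh] [[dz z0 Iz]] /= zs.
have [cI lI mI I0] := initial_arcP hh.
have pi0 := @pi_gt0 R.
have s01 : (0 < s <= 1)%R by rewrite s0 (le_trans sh)//; move: hh => /andP[_ ?]; lra.
have s1 : (0 <= 1 - s)%R by rewrite subr_ge0; case/andP: s01.
have s1' : (1 - s <= 1)%R by rewrite gerBl ltW.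
have [a /andP[a0 ah] Jz] := subarc_containing s0 sh Iz.
have hs : (2 * pi * (h - s) + 2 * pi * s = 2 * pi * h)%R.
  by rewrite -mulrDr subrK.
have hpi : (2 * pi * h <= pi)%R.
  rewrite mulrAC -[leRHS]mul1r (ler_wpM2r (ltW pi0))//.
  by move: hh => /andP[_ ?]; lra.
have aspi : (a + 2 * pi * s <= 2 * pi * h)%R by rewrite -hs lerD2r.
have [cJ lJ mJ J0] := small_arc a0 s0 (le_trans aspi hpi).
set J := angle_arc a _ in Jz cJ lJ mJ J0.
have cJE : carleson J = sector J (1 - s) 1 by rewrite carlesonE lJ.
have cIE : carleson (initial_arc h) = sector (initial_arc h) (1 - h) 1.
  by rewrite carlesonE lI.
have JI : carleson J `<=` carleson (initial_arc h).
  rewrite cJE cIE => y [[dy y0 [t /= ht yt]]] /=; rewrite !in_itv/=.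
  move=> /andP[y1 y2]; split=> /=.
    split=> //; exists t => //=; move: ht; rewrite !in_itv/= => /andP[ta tb].
    by rewrite (le_trans a0 ta) (le_trans tb aspi).
  by rewrite in_itv/= y2 andbT (le_lt_trans _ y1)// lerD2l lerN2.
have finI := area_fan_fin mI; have finJ := area_fan_fin mJ.
have sI : (0 < fine (area (fan (initial_arc h))))%R.
  by rewrite fine_gt0// I0 ltey_eq finI.
have sJ : (0 < fine (area (fan J)))%R by rewrite fine_gt0// J0 ltey_eq finJ.
have aJ : fine (area (carleson J)) =
    ((1 ^+ 2 - (1 - s) ^+ 2) * fine (area (fan J)))%R.
  by rewrite cJE (fine_area_sector mJ s1 s1' (lexx _)).
have intJ : \int[area]_(y in carleson J) `|(w \_ (carleson (initial_arc h))) y| =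
    (smass w J (1 - s) 1)%:E.
  rewrite -(smassE phi_ge0 wphi iw _ _ mJ) /mass -cJE.
  apply: eq_integral => y /set_mem Jy.
  rewrite patchE mem_set; last exact: JI.
  have dy : disc y by case: Jy.
  by rewrite wphi//= ger0_norm// phi_ge0// cmod_ge0.
apply: le_trans (_ : _ <= (fine (area (carleson J)))^-1%:E *
   \int[area]_(y in carleson J) `|(w \_ (carleson (initial_arc h))) y|) _; last first.
  apply: ereal_sup_ubound; exists J => //; split=> //.
  by rewrite cJE; split=> //; split.
rewrite intJ -EFinM lee_fin aJ.
exact: (average_transfer (smass_ge0 phi_ge0 wphi J (1 - s) 1) sI sJ s01
  (smass_fan mphi phi_ge0 wphi iw (1 - s) 1 mI mJ I0 J0)).
Qed.

(** Integrate over the [n] disjoint dyadic bands the simple function [g], which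
is at most the maximal function: every band contributes at least a quarter of
the mass of [|z| > 1 - h / 2 ^ n]. *)
Lemma P7_bands : exists2 C : R, (0 < C)%R & forall (n : nat) (h : R),
  (0 < h <= 2^-1)%R ->
  (n%:R * smass w (initial_arc h) (1 - h / 2 ^+ n) 1 <=
    C * smass w (initial_arc h) (1 - h) 1)%R.
Proof.
have [_ [C C0 hP7]] := w_P7; exists (4 * C)%R; first by rewrite mulr_gt0.
move=> n h hh.
have [cI lI mI I0] := initial_arcP hh.
have cIE : carleson (initial_arc h) = sector (initial_arc h) (1 - h) 1.
  by rewrite carlesonE lI.
have finI := area_fan_fin mI.
have sI : (0 < fine (area (fan (initial_arc h))))%R.
  by rewrite fine_gt0// I0 ltey_eq finI.
have h0 : (0 < h)%R by case/andP: hh.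
have h1 : (h <= 1)%R by move: hh => /andP[_ ?]; lra.
pose s (k : nat) : R := (h / 2 ^+ k)%R.
have s0 k : (0 < s k)%R by rewrite divr_gt0// exprn_gt0.
have s_dec k l : (k <= l)%N -> (s l <= s k)%R.
  move=> kl; rewrite /s ler_pM2l// lef_pV2 ?posrE ?exprn_gt0//.
  by rewrite ler_eXn2l// ltr1n.
have sS k : (s k.+1 = s k / 2)%R.
  by rewrite /s exprSr invfM mulrA.
have s_le k : (s k <= h)%R.
  by have := s_dec _ _ (leq0n k); rewrite {2}/s expr0 divr1.
have s_half k : (0 < s k <= 2^-1)%R.
  by rewrite s0 (le_trans (s_le k))//; case/andP: hh.
have s_in k : (0 < s k <= h)%R by rewrite s0 s_le.
have p0 k : (0 <= 1 - s k)%R by rewrite subr_ge0 (le_trans (s_le k)).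
have p1 k : (1 - s k <= 1)%R by rewrite gerBl ltW.
have p_inc k l : (k <= l)%N -> (1 - s k <= 1 - s l)%R.
  by move=> kl; rewrite lerD2l lerN2 s_dec.
pose m := smass w (initial_arc h) (1 - s n) 1.
have m0 : (0 <= m)%R by exact: (smass_ge0 phi_ge0 wphi).
pose c (k : nat) : R := (m / (2 * s k * fine (area (fan (initial_arc h)))))%R.
have c0 k : (0 <= c k)%R.
  by rewrite divr_ge0// !mulr_ge0// ltW.
pose band (k : nat) := sector (initial_arc h) (1 - s k) (1 - s k.+1).
have mband k : measurable (band k) by exact: measurable_sector.
have band_sub k : band k `<=` carleson (initial_arc h).
  rewrite cIE => z [zI] /=; rewrite in_itv/= => /andP[z1 z2]; split=> //=.
  by rewrite in_itv/= (le_trans z2 (p1 _)) (le_lt_trans _ z1)// lerD2l lerN2.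
have mQ : measurable (carleson (initial_arc h)).
  by rewrite cIE; exact: measurable_sector.
pose g (z : plane R) : \bar R :=
  \sum_(k < n) (c k)%:E * (\1_(band k) z)%:E.
have g0 z : 0 <= g z.
  by apply: sume_ge0 => k _; rewrite mule_ge0// lee_fin.
have max_ge k z : (k < n)%N -> band k z ->
    (c k)%:E <= maximal (w \_ (carleson (initial_arc h))) z.
  move=> kn [zI] /=; rewrite in_itv/= => /andP[z1 z2].
  have zk : sector (initial_arc h) (1 - s k) 1 z.
    by split=> //=; rewrite in_itv/= z1 (le_trans z2).
  apply: le_trans (maximal_ge hh (s_in k) zk).
  rewrite lee_fin /c ler_pM2r ?invr_gt0 ?mulr_gt0//.
  by apply: (smass_mono phi_ge0 wphi iw mI _ (p1 n)); exact/p_inc/ltnW.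
have max_ge0 z : carleson (initial_arc h) z ->
    0 <= maximal (w \_ (carleson (initial_arc h))) z.
  move=> Qz; have zs : sector (initial_arc h) (1 - s 0%N) 1 z.
    by rewrite /s expr0 divr1 -cIE.
  apply: le_trans (maximal_ge hh (s_in 0%N) zs).
  by rewrite lee_fin divr_ge0 ?(smass_ge0 phi_ge0 wphi)// !mulr_ge0// ltW.
have g_le z : carleson (initial_arc h) z ->
    g z <= maximal (w \_ (carleson (initial_arc h))) z.
  move=> Qz; have [[k zk]|nz] := pselect (exists k : 'I_n, band k z).
    rewrite /g (bigD1 k)//= big1 ?adde0.
      by rewrite indicE mem_set// mule1; exact: max_ge.
    move=> l lk; rewrite indicE memNset ?mule0// => zl.
    move: zk zl => [_] /= + [_] /=; rewrite !in_itv/= => /andP[a1 a2] /andP[b1 b2].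
    have [kl|lk'|/val_inj kl] := ltngtP k l.
    - by have := lt_le_trans b1 (le_trans a2 (p_inc _ _ kl)); rewrite ltxx.
    - by have := lt_le_trans a1 (le_trans b2 (p_inc _ _ lk')); rewrite ltxx.
    - by rewrite kl eqxx in lk.
  rewrite /g big1 ?max_ge0// => k _.
  by rewrite indicE memNset ?mule0// => zk; apply: nz; exists k.
have ind_ge0 k z : 0 <= (c k)%:E * (\1_(band k) z)%:E.
  by rewrite mule_ge0// lee_fin.
have mind k : measurable_fun (carleson (initial_arc h))
    (fun z => (\1_(band k) z)%:E : \bar R).
  by apply/measurable_EFinP; exact: measurable_indic.
have int_g : \int[area]_(z in carleson (initial_arc h)) g z =
    \sum_(k < n) (c k)%:E * area (band k).
  rewrite /g ge0_integral_sum//; last first.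
    by move=> k; apply: measurable_funeM.
  apply: eq_bigr => k _; rewrite ge0_integralZl_EFin//.
  by rewrite integral_indic// setIidl.
have aband k : area (band k) = (((1 - s k / 2) ^+ 2 - (1 - s k) ^+ 2) *
    fine (area (fan (initial_arc h))))%:E.
  rewrite -sS; exact: (fine_area_sector mI (p0 k) (p_inc _ _ (leqnSn k)) (p1 _)).
have lower : (n%:R * (m / 4))%:E <= \int[area]_(z in carleson (initial_arc h)) g z.
  rewrite int_g.
  rewrite [leLHS](_ : _ = \sum_(k < n) (m / 4)%:E); last first.
    by rewrite sumEFin sumr_const card_ord mulr_natl.
  apply: lee_sum => k _; rewrite aband -EFinM lee_fin.
  exact: (band_area_ge m0 (s_half k) sI).
have upper := le_trans lower (le_trans (ge0_le_integralr _ (fun z _ => g0 z) g_le)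
  (hP7 _ cI)).
move: upper; rewrite cIE (smassE phi_ge0 wphi iw _ _ mI) -EFinM lee_fin mulrA.
by rewrite ler_pdivrMr// [leRHS]mulrC mulrA.
Qed.

Lemma increasing_doubling : exists h0 C : R,
  [/\ (0 < h0 <= 4^-1)%R, (0 <= C)%R &
  forall h, (0 < h <= h0)%R -> (phi (1 - h / 2) <= C * phi (1 - h))%R].
Proof.
have [C C0 hC] := P7_bands.
(* With this [n], at most half of the mass lies in [|z| > 1 - H / 2 ^ n]. *)
have [n hn] : exists n : nat, (2 * C <= n%:R)%R.
  exists (Num.bound (2 * C)); apply/ltW/archi_boundP.
  by rewrite mulr_ge0// ltW.
have e0 : (1 <= 2 ^+ n :> R)%R by rewrite exprn_ege1// ler1n.
have e1 : (0 < 2 ^+ n :> R)%R by rewrite exprn_gt0.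
exists (4^-1 / 2 ^+ n)%R, (4 * 2 ^+ n)%R; split.
- by rewrite divr_gt0//= ler_pdivrMr// ler_peMr.
- by rewrite mulr_ge0// ltW.
move=> h /andP[h0]; rewrite ler_pdivlMr// => hE.
have [H HE] : exists H : R, h = (H / 2 ^+ n)%R.
  by exists (h * 2 ^+ n)%R; rewrite mulfK// gt_eqF.
have HhE : (H = h * 2 ^+ n)%R by rewrite HE divfK// gt_eqF.
have H4 : (H <= 4^-1)%R by rewrite HhE.
have hH : (h <= H)%R by rewrite HhE ler_peMr// ltW.
have H0 : (0 < H)%R by exact: lt_le_trans hH.
have HH : (0 < H <= 2^-1)%R by rewrite H0; lra.
have := hC n H HH; rewrite -HE => nC.
have [cI lI mI I0] := initial_arcP HH.
have finI := area_fan_fin mI.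
have sI : (0 < fine (area (fan (initial_arc H))))%R.
  by rewrite fine_gt0// I0 ltey_eq finI.
have p1 : (0 <= 1 - H)%R by lra.
have p2 : (1 - H <= 1 - h)%R by lra.
have p3 : (1 - h <= 1 - h / 2)%R by lra.
have p4 : (1 - h / 2 < 1)%R by lra.
have p5 : (1 - h < 1)%R by lra.
have sum := smassD phi_ge0 wphi iw mI p2 (ltW p5).
have mono := smass_mono phi_ge0 wphi iw mI p3 (ltW p4).
have m0 := smass_ge0 phi_ge0 wphi (initial_arc H) (1 - h) 1.
have ph1 := phi_ge0 (introT andP (conj (le_trans p1 p2) p5)).
have ph2 := phi_ge0 (introT andP (conj (le_trans (le_trans p1 p2) p3) p4)).
have upper := smass_le phi_ge0 wphi iw (U := phi (1 - h)) mI p1 p2 (ltW p5).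
have {}upper := upper (fun r hr hrb =>
  phi_inc (le_trans p1 (ltW (proj1 (andP hr)))) hrb p5).
have lower := smass_ge phi_ge0 wphi iw (L := phi (1 - h / 2)) mI
  (le_trans (le_trans p1 p2) p3) (ltW p4) (lexx _) ph2.
have {}lower := lower (fun r hr _ =>
  phi_inc (le_trans (le_trans p1 p2) p3) (ltW (proj1 (andP hr)))
    (proj2 (andP hr))).
have BA : (2 * smass w (initial_arc H) (1 - h) 1 <= smass w (initial_arc H) (1 - H) 1)%R.
  rewrite -(ler_pM2l C0) mulrA (mulrC C).
  by apply: le_trans nC; exact: ler_wpM2r.
have BE : (smass w (initial_arc H) (1 - h) 1 <= smass w (initial_arc H) (1 - H) (1 - h))%R.
  by move: BA; rewrite mulr2n mulrDl mul1r sum lerD2r.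
have chain := le_trans lower (le_trans mono (le_trans BE upper)).
clear -chain HhE h0 H0 hH H4 sI ph1 ph2.
move: chain; rewrite !mulrA ler_pM2r//.
move: (phi (1 - h / 2))%R (phi (1 - h))%R ph1 ph2 => p q q0 p0 chain.
have a1 : (h / 2 <= 1 ^+ 2 - (1 - h / 2) ^+ 2)%R by nra.
have a2 : ((1 - h) ^+ 2 - (1 - H) ^+ 2 <= 2 * H)%R by nra.
have chain2 : (p * (h / 2) <= q * (2 * H))%R.
  apply: le_trans (ler_wpM2l p0 a1) (le_trans chain _).
  exact: ler_wpM2l.
rewrite -(ler_pM2r h0) -(ler_pM2l (_ : 0 < 2^-1)%R)//.
move: chain2; congr (_ <= _)%R; first by field.
by rewrite HhE; field.
Qed.

End increasing_profile.

(** * From doubling of the profile to the weight *)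

Section conclusion.
Context {R : realType}.
Variable w : plane R -> \bar R.

(** Almost every point with [|z| > p] in the disc qualifies, and these points
form a set of positive area. It yields finiteness of an increasing profile and
positivity of a decreasing one at radii below [|z|]. *)
Lemma weight_good_point (p : R) : weight w -> (0 <= p < 1)%R ->
  exists z, [/\ disc z, (p <= cmod z)%R & 0 < w z < +oo].
Proof.
move=> [_ _ [N [mN N0 subN]]] /andP[p0 p1].
have pi0 := @pi_gt0 R.
have mI := measurable_fan_arc (lexx _) pi0 (lexx _).
have I0 := area_fan_arc_gt0 (lexx _) pi0 (lexx _).
set I := angle_arc _ _ in mI I0.
apply: contrapT => nz.
have sub : sector I p 1 `<=` N.
  move=> z [[dz _ _]] /=; rewrite in_itv/= => /andP[pz _]; apply: subN => h.
  by apply: nz; exists z; split; [|exact: ltW|exact: h].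
have : area (sector I p 1) <= area N.
  by apply: le_measure; rewrite ?inE//; exact: measurable_sector.
rewrite N0 (area_sector mI p0 (ltW p1) (lexx _)) leNgt mule_gt0//.
by rewrite lte_fin subr_gt0 expr1n expr_lt1.
Qed.

Lemma almost_constant_of_bounds (C : R) : (1 <= C)%R ->
  (forall I, circle_arc I -> exists2 m : R, (0 <= m)%R &
    forall z, top_half I z -> m%:E <= w z <= (C * m)%:E) ->
  almost_constant_on_top_halves w.
Proof.
move=> C1 h; exists C => // I /h[m m0 hm].
apply: (@le_trans _ _ (C * m)%:E).
  apply/ess_supP; apply: nearW => z; rewrite /= /patch.
  by case: ifPn => [/set_mem /hm /andP[]|] //; rewrite leNye.
rewrite EFinM lee_wpmul2l ?lee_fin//; first exact: le_trans C1.
apply/ess_infP; apply: nearW => z; rewrite /= /patch.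
by case: ifPn => [/set_mem /hm /andP[]|] //; rewrite leey.
Qed.

(** Top halves of arcs longer than [h0] lie in the disc of radius [1 - h0 / 2],
where the bounds [m] and [M] apply. *)
Lemma almost_constant_of_profile (phi : R -> R) (h0 C m M : R) :
  (forall z, disc z -> w z = (phi (cmod z))%:E) ->
  (0 < h0 <= 1)%R -> (0 < m)%R ->
  (forall r, (0 <= r <= 1 - h0 / 2)%R -> (m <= phi r <= M)%R) ->
  (forall h, (0 < h <= h0)%R -> exists2 l : R, (0 <= l)%R &
    forall r, (1 - h <= r <= 1 - h / 2)%R -> (l <= phi r <= C * l)%R) ->
  almost_constant_on_top_halves w.
Proof.
move=> wphi /andP[h00 h01] m0 far near.
pose K := (1 + `|C| + `|M / m|)%R.
have K1 : (1 <= K)%R by rewrite /K -addrA lerDl addr_ge0.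
have KC : (C <= K)%R.
  by rewrite /K (le_trans (ler_norm C))// -addrA addrCA lerDl addr_ge0.
have KM : (M <= K * m)%R.
  rewrite -ler_pdivrMr// (le_trans (ler_norm _))// /K lerDr.
  by rewrite addr_ge0.
apply: (almost_constant_of_bounds K1) => I [_ I0].
have [hI|hI] := leP (arc_length I) h0.
  have [l l0 hl] := near (arc_length I) (introT andP (conj I0 hI)).
  exists l => // z [dz _ _ /andP[z1 z2]].
  rewrite wphi// !lee_fin.
  have /andP[-> h2] : (l <= phi (cmod z) <= C * l)%R by apply: hl; lra.
  by rewrite (le_trans h2)// ler_wpM2r.
exists m; first exact: ltW.
move=> z [dz _ _ /andP[z1 z2]].
rewrite wphi// !lee_fin.
have /andP[-> h2] : (m <= phi (cmod z) <= M)%R.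
  by apply: far; rewrite cmod_ge0/=; lra.
exact: le_trans h2 KM.
Qed.

Lemma real_profile (f : R -> \bar R) : radial_profile w f ->
  (forall r, (0 <= r < 1)%R -> f r < +oo) ->
  let phi := fine \o f in
  [/\ measurable_fun [set r : R | (0 <= r < 1)%R] (EFin \o phi),
      forall r, (0 <= r < 1)%R -> (0 <= phi r)%R,
      forall r, (0 <= r < 1)%R -> f r = (phi r)%:E
    & forall z, disc z -> w z = (phi (cmod z))%:E].
Proof.
move=> [mf f0 wf] foo phi.
have fE r : (0 <= r < 1)%R -> f r = (phi r)%:E.
  by move=> hr; rewrite /phi/= fineK// ge0_fin_numE ?f0 ?foo.
split=> //.
- by apply: eq_measurable_fun mf => r /set_mem; exact: fE.
- by move=> r hr; rewrite -lee_fin -fE// f0.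
- by move=> z dz; rewrite wf// fE// cmod_ge0.
Qed.

End conclusion.

Theorem theorem1p6 (R : realType) (w : plane R -> \bar R)
    (w_weight : weight w)
    (w_radial : radial w)
    (w0 : (0 < w (0%R, 0%R) < +oo)%E)
    (hw : (radially_increasing w /\ P7 w) \/ (radially_decreasing w /\ P4 w)) :
  almost_constant_on_top_halves w.
Proof.
have c0 : cmod ((0, 0) : plane R)%R = 0%R.
  by rewrite /cmod/= expr0n addr0 sqrtr0.
have d0 : @disc R (0, 0)%R by rewrite /disc/= c0 ltr01.
have z01 : (0 <= (0 : R) < 1)%R by rewrite lexx ltr01.
case: hw => -[[f fw f_mono] hP].
- have foo r : (0 <= r < 1)%R -> f r < +oo.
    move=> hr; have [z [dz rz /andP[_ wz]]] := weight_good_point w_weight hr.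
    apply: le_lt_trans wz; case: fw => _ _ ->//.
    by apply: f_mono => //; case/andP: hr.
  have [mphi phi0 fE wphi] := real_profile fw foo.
  set phi := fine \o f in mphi phi0 fE wphi.
  have phi_inc r s : (0 <= r)%R -> (r <= s)%R -> (s < 1)%R ->
      (phi r <= phi s)%R.
    move=> r0 rs s1; rewrite -lee_fin -!fE ?r0 ?(le_trans r0 rs) ?(le_lt_trans rs)//.
    exact: f_mono.
  have [h0 [C [/andP[h00 h04] C0 hC]]] :=
    increasing_doubling mphi phi0 wphi phi_inc hP.
  apply: (almost_constant_of_profile (h0 := h0) (C := C) (m := phi 0%R)
    (M := phi (1 - h0 / 2)%R) wphi).
  + by rewrite h00; lra.
  + by move: w0 => /andP[+ _]; rewrite wphi// c0 lte_fin.
  + move=> r /andP[r0 r1]; apply/andP; split; apply: phi_inc => //; lra.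
  + move=> h /andP[hh hh0]; exists (phi (1 - h)%R); first by apply: phi0; lra.
    move=> r /andP[r1 r2]; apply/andP; split; first by apply: phi_inc; lra.
    by apply: le_trans (hC h _); [apply: phi_inc; lra|rewrite hh].
- have f0oo : f 0%R < +oo.
    by move: w0 => /andP[_]; case: fw => _ _ ->//; rewrite c0.
  have foo r : (0 <= r < 1)%R -> f r < +oo.
    by move=> /andP[r0 r1]; apply: le_lt_trans f0oo; exact: f_mono.
  clear f0oo.
  have [mphi phi0 fE wphi] := real_profile fw foo.
  set phi := fine \o f in mphi phi0 fE wphi.
  have phi_dec r s : (0 <= r)%R -> (r <= s)%R -> (s < 1)%R ->
      (phi s <= phi r)%R.
    move=> r0 rs s1; rewrite -lee_fin -!fE ?r0 ?(le_trans r0 rs) ?(le_lt_trans rs)//.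
    exact: f_mono.
  have [C C0 hC] := decreasing_doubling phi0 wphi phi_dec hP.
  have pos : (0 < phi (1 - 4^-1 / 2))%R.
    pose h0 : R := 4^-1%R; have h00 : (0 < h0 < 1)%R by rewrite /h0; lra.
    have hp : (0 <= 1 - h0 / 2 < 1)%R by lra.
    have [z [dz rz /andP[wz _]]] := weight_good_point w_weight hp.
    rewrite -lte_fin; apply: lt_le_trans wz _; rewrite wphi// lee_fin.
    by apply: phi_dec => //; case/andP: hp.
  apply: (almost_constant_of_profile (h0 := 4^-1%R) (C := C)
    (m := phi (1 - 4^-1 / 2)%R) (M := phi 0%R) wphi) => //.
  + lra.
  + move=> r /andP[r0 r1]; apply/andP; split; apply: phi_dec => //; lra.
  + move=> h /andP[hh hh0]; exists (phi (1 - h / 2)%R).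
      by apply: phi0; lra.
    move=> r /andP[r1 r2]; apply/andP; split; first by apply: phi_dec; lra.
    by apply: le_trans (hC h _); [apply: phi_dec; lra|rewrite hh].
Qed.
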